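(* Let $G$ be a connected graph, $n\ge 3$ an integer, $t\le\delta(G)$ a positive integer, and $d=dyn_t(G)$. Then $dyn_t(G\Box C_n)\le n+d-2$ if $t=2$; $dyn_t(G\Box C_n)\le nd-(n+d)+2$ if $t=3$; $dyn_t(G\Box C_n)\le d+(n-2)(d-1)+d-2$ if $t\ge 4$.
   Context: $\delta(G)$ is the minimum degree of $G$; $C_n$ is the cycle on $n$ vertices; $G\Box H$ is the Cartesian product (vertex set $V(G)\times V(H)$, $(u,v)\sim(u',v')$ iff $u=u'$ and $vv'\in E(H)$, or $v=v'$ and $uu'\in E(G)$). For constant threshold $t$, a set $D$ of vertices is a $t$-dynamic monopoly if starting from $D$ and repeatedly adding any vertex having at least $t$ neighbors in the current set eventually yields all vertices; $dyn_t(G)$ is the minimum size of a $t$-dynamic monopoly. *)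

(* Defs.v *)
From mathcomp Require Import all_boot all_order all_algebra.

Set Implicit Arguments.
Unset Strict Implicit.
Unset Printing Implicit Defensive.

(* A finite simple graph is a symmetric irreflexive relation on a finType. *)
Definition simple_graph (T : finType) (e : rel T) : Prop :=
  symmetric e /\ irreflexive e.

(* The graph without vertices is not connected. *)
Definition connected_graph (T : finType) (e : rel T) : Prop :=
  0 < #|T| /\ forall x y : T, connect e x y.

Definition degree (T : finType) (e : rel T) (x : T) : nat :=
  #|[set y | e x y]|.

(* For a nonempty simple graph all degrees are less than #|T|, so the default
   value of the iterated minimum plays no role. *)
Definition min_degree (T : finType) (e : rel T) : nat :=
  \big[minn/#|T|]_(x : T) degree e x.

Definition cart_prod (T U : finType) (e : rel T) (f : rel U) : rel (T * U) :=
  fun p q => ((p.1 == q.1) && f p.2 q.2) || ((p.2 == q.2) && e p.1 q.1).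

(* A simple graph, namely the cycle C_n, only for n >= 3. *)
Definition cycle_graph (n : nat) : rel 'I_n :=
  fun i j => (i.+1 %% n == j) || (j.+1 %% n == i).

(* One step of the process: a vertex x with at least t neighbours in the current
   set X is added to X. *)
Definition activation (T : finType) (e : rel T) (t : nat) : rel {set T} :=
  fun X Y => [exists x, (t <= #|[set y in X | e x y]|) && (Y == x |: X)].

(* connect is the reflexive transitive closure. *)
Definition dynamic_monopoly (T : finType) (e : rel T) (t : nat) (D : {set T})
    : bool :=
  connect (activation e t) D [set: T].

Definition dyn (T : finType) (e : rel T) (t : nat) : nat :=
  #|[arg min_(D < [set: T] | dynamic_monopoly e t D) #|D| ]|.

Lemma dynamic_monopolyT (T : finType) (e : rel T) (t : nat) :
  dynamic_monopoly e t [set: T].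
Proof. exact: connect0. Qed.

Lemma dyn_witness (T : finType) (e : rel T) (t : nat) :
  exists2 D : {set T}, dynamic_monopoly e t D & #|D| = dyn e t.
Proof.
rewrite /dyn; case: arg_minnP => [|D dD _]; first exact: dynamic_monopolyT.
by exists D.
Qed.

Lemma dyn_le (T : finType) (e : rel T) (t : nat) (D : {set T}) :
  dynamic_monopoly e t D -> dyn e t <= #|D|.
Proof.
rewrite /dyn; case: arg_minnP => [|X _ minX]; first exact: dynamic_monopolyT.
exact: minX.
Qed.

Lemma cart_prod_simple (T U : finType) (e : rel T) (f : rel U) :
  simple_graph e -> simple_graph f -> simple_graph (cart_prod e f).
Proof.
move=> [es ei] [fs fi]; split=> [[x u] [y v]|[x u]]; rewrite /cart_prod /=.
  by rewrite es fs (eq_sym x) (eq_sym u).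
by rewrite ei fi !andbF.
Qed.

Lemma cycle_graph_simple (n : nat) : 2 < n -> simple_graph (@cycle_graph n).
Proof.
move=> n_gt2; split=> [i j|i]; first by rewrite /cycle_graph orbC.
rewrite /cycle_graph orbb; apply/negbTE.
have := ltn_ord i; rewrite leq_eqVlt => /orP[/eqP ni|ni]; last first.
  by rewrite modn_small // eqn_leq ltnn.
by rewrite ni modnn; apply/eqP => i0; move: n_gt2; rewrite -ni -i0.
Qed.

(* Main.v *)
Require Import Defs.
From mathcomp Require Import all_boot all_order all_algebra.
From mathcomp Require Import zify.

Set Implicit Arguments.
Unset Strict Implicit.
Unset Printing Implicit Defensive.

(** Removing k vertices from a t-monopoly D leaves a (t-k)-monopoly, since all
    degrees are at least t.  Hence one layer activated by D fills the next
    layers one after the other if each contains d - 1 vertices of D, and the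
    last layer, between two full ones, only needs a (t-2)-monopoly: the empty
    set for t = 2, and d - 2 vertices of D for t >= 4.

    For t = 3 this would cost one vertex too many, because the last layer needs
    one vertex x.  So layer 0 receives only D minus a vertex v.  In activation
    order, layer 0 then gets stuck only at the neighbours of v, and it is
    completed by help from the two adjacent layers at v and at its first two
    neighbours.  If v has a neighbour in D, then D minus another vertex in
    layer 1, and the other early neighbour of v as x, do this.  If D is
    independent, let y be the first activated vertex; for three neighbours v, u,
    u' of y in D, layer 1 receives y and D minus u, u', and x is the second
    neighbour of v.  Layer 1 recovers u, provided that u and v have the same
    second neighbour or that u acquires its second neighbour before u' does;
    some labelling of the three neighbours satisfies this. *)

(** * Closed sets and dynamic monopolies *)

Definition threshold_closed (T : finType) (e : rel T) (t : nat) (A : {set T}) :=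
  forall x, t <= #|[set y in A | e x y]| -> x \in A.

Lemma leq_card_nbrs (T : finType) (e : rel T) (x : T) (A B : {set T}) :
  A \subset B -> #|[set y in A | e x y]| <= #|[set y in B | e x y]|.
Proof.
move=> AB; apply/subset_leq_card/subsetP => y; rewrite !inE => /andP[yA ->].
by rewrite (subsetP AB).
Qed.

(** A largest set reachable from [D] is closed, and a closed set containing [D] absorbs every
    activation. *)
Lemma dynamic_monopolyP (T : finType) (e : rel T) (t : nat) (D : {set T}) :
  dynamic_monopoly e t D <->
  forall A : {set T}, D \subset A -> threshold_closed e t A -> A = setT.
Proof.
split=> [/connectP[p pth TE] A DA cA|H]; last first.
  case: (@arg_maxnP _ D (connect (activation e t) D) (fun X => #|X|)).
    exact: connect0.
  move=> X DX maxX.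
  rewrite /dynamic_monopoly; suff <- : X = setT by [].
  apply: H.
    case/connectP: DX => p pth -> {maxX X}.
    elim: p D pth => //= Y p IH D /andP[/existsP[x /andP[_ /eqP ->]] /IH].
    by apply: subset_trans; apply: subsetUr.
  move=> x xt; have : #|x |: X| <= #|X|.
    apply: maxX; apply: connect_trans DX _; apply: connect1.
    by apply/existsP; exists x; rewrite xt eqxx.
  rewrite cardsU1; case: (x \in X) => //=; lia.
apply/eqP; rewrite eqEsubset subsetT /= TE {TE}.
elim: p D DA pth => //= Y p IH D DA /andP[/existsP[x /andP[xt /eqP ->]]].
apply: IH; rewrite subUset DA andbT sub1set.
by apply: cA; apply: leq_trans xt _; apply: leq_card_nbrs.
Qed.

Lemma min_degree_le (T : finType) (e : rel T) (x : T) :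
  min_degree e <= degree e x.
Proof.
rewrite /min_degree; have := mem_index_enum x.
elim: (index_enum T) => //= a s IH; rewrite inE big_cons geq_min.
by case/predU1P=> [->|/IH ->]; rewrite ?leqnn ?orbT.
Qed.

Lemma card_nbrs_loss (T : finType) (e : rel T) (x : T) (A B : {set T}) k :
  #|B :\: A| <= k ->
  #|[set y in B | e x y]| - k <= #|[set y in A | e x y]|.
Proof.
move=> kBA.
suff : #|[set y in B | e x y]| <= #|[set y in A | e x y]| + #|B :\: A| by lia.
apply: leq_trans (leq_card_setU _ _); apply/subset_leq_card/subsetP => y.
by rewrite !inE => /andP[-> ->]; case: (y \in A).
Qed.

(** If [A] is closed and contains [S], at most [k] vertices of [D] lie outside [A]. So [A :|: D] is
    closed at threshold [t], hence everything, and then the degrees give every vertex [t - k]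
    neighbours in [A]. *)
Lemma dynamic_monopoly_drop (T : finType) (e : rel T) (t k : nat) (D S : {set T}) :
  (forall x, t <= degree e x) -> dynamic_monopoly e t D -> #|D :\: S| <= k ->
  dynamic_monopoly e (t - k) S.
Proof.
move=> deg /dynamic_monopolyP dD kDS; apply/dynamic_monopolyP => A SA cA.
have kDA : #|D :\: A| <= k.
  exact: leq_trans (subset_leq_card (setDS _ SA)) kDS.
have ADT : A :|: D = setT.
  apply: dD; first exact: subsetUr.
  move=> x xt; rewrite inE cA //.
  apply: leq_trans (leq_sub2r k xt) _.
  by apply: card_nbrs_loss; rewrite setDUl setDv set0U.
apply/setP => x; rewrite inE cA //.
apply: leq_trans (leq_sub2r k (deg x)) _.
rewrite /degree (_ : [set y | e x y] = [set y in A :|: D | e x y]).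
  by apply: card_nbrs_loss; rewrite setDUl setDv set0U.
by rewrite ADT; apply/setP => y; rewrite !inE.
Qed.

(** With fewer than [t] vertices [D] is already closed, hence everything, which the degrees
    forbid. *)
Lemma dynamic_monopoly_card_ge (T : finType) (e : rel T) (t : nat) (D : {set T}) :
  0 < #|T| -> (forall x, t <= degree e x) -> dynamic_monopoly e t D -> t <= #|D|.
Proof.
move=> /card_gt0P[x _] deg /dynamic_monopolyP dD; rewrite leqNgt; apply/negP => Dt.
have DT : D = setT.
  apply: dD => // y yt; suff : t <= #|D| by rewrite leqNgt Dt.
  apply: leq_trans yt _; apply/subset_leq_card/subsetP => z.
  by rewrite inE => /andP[].
have := leq_trans (deg x) (subset_leq_card (subsetT _)).
by rewrite -DT leqNgt Dt.
Qed.

Lemma connected_dynamic_monopoly1 (T : finType) (e : rel T) (x : T) :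
  symmetric e -> (forall y z, connect e y z) -> dynamic_monopoly e 1 [set x].
Proof.
move=> es ec; apply/dynamic_monopolyP => A; rewrite sub1set => xA cA.
apply/setP => y; rewrite inE.
case/connectP: (ec x y) => p pth ->.
elim: p x xA pth => //= z p IH x xA /andP[xz]; apply: IH; apply: cA.
by apply/card_gt0P; exists x; rewrite inE xA es.
Qed.

(** * Activation orders *)

Definition activation_rank (T : finType) (e : rel T) (t : nat) (D : {set T})
    (r : T -> nat) : Prop :=
  [/\ forall x, (r x == 0) = (x \in D),
      forall x y, x \notin D -> r x = r y -> x = y
    & forall y, y \notin D -> t <= #|[set z | (r z < r y) && e y z]|].

Lemma activation_rank_exists (T : finType) (e : rel T) (t : nat) (D : {set T}) :
  dynamic_monopoly e t D -> exists r, activation_rank e t D r.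
Proof.
have [k] := ubnP #|~: D|; elim: k D => // k IH D Dk dD.
have [DT|DnT] := eqVneq D setT.
  by exists (fun=> 0); split=> x; rewrite DT inE.
have [x xD xt] : exists2 x, x \notin D & t <= #|[set y in D | e x y]|.
  have [/existsP[x /andP[xD xt]]|] :=
      boolP [exists x, (x \notin D) && (t <= #|[set y in D | e x y]|)].
    by exists x.
  move=> /existsPn H; case/eqP: DnT; apply: (proj1 (dynamic_monopolyP _ _ _) dD) => // x xt.
  by have := H x; rewrite xt andbT negbK.
have dD' : dynamic_monopoly e t (x |: D).
  apply/dynamic_monopolyP => A; rewrite subUset => /andP[_ DA].
  exact: (proj1 (dynamic_monopolyP _ _ _) dD).
have [|r [r0 rinj rt]] := IH (x |: D) _ dD'.
  have : #|~: (x |: D)| < #|~: D|.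
    apply: proper_card; apply/properP; split; first by rewrite setCS subsetUr.
    by exists x; rewrite !inE ?eqxx.
  lia.
(* Vertices outside [x |: D] have positive rank, so shifting by one leaves rank 1 free for [x], the
   first vertex activated. *)
pose q z := if z \in D then 0 else if z == x then 1 else (r z).+1.
have rpos z : z \notin D -> z != x -> 0 < r z.
  by move=> zD zx; rewrite lt0n r0 !inE (negbTE zx).
exists q; split=> [z|z y zD|y yD].
- by rewrite /q; case: (z \in D) => //; case: (z == x).
- rewrite /q (negbTE zD); case: (boolP (y \in D)) => yD; first by case: (z == x).
  have := rpos z zD; have := rpos y yD.
  case: (eqVneq z x) => [->|zx]; case: (eqVneq y x) => [->|yx] //.
  + by move=> /(_ isT) yp _ [y0]; rewrite -y0 in yp.
  + by move=> _ /(_ isT) zp [z0]; rewrite z0 in zp.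
  + by move=> _ _ [/rinj]; apply; rewrite !inE negb_or zx.
- have [->|yx] := eqVneq y x.
    apply: leq_trans xt _; apply/subset_leq_card/subsetP => z.
    by rewrite !inE => /andP[zD ->]; rewrite /q zD (negbTE xD) eqxx.
  have yxD : y \notin x |: D by rewrite !inE negb_or yx.
  apply: leq_trans (rt y yxD) _; apply/subset_leq_card/subsetP => z.
  rewrite !inE => /andP[zy ->]; rewrite andbT /q (negbTE yD) (negbTE yx).
  by case: (z \in D) => //; case: (z == x) => //; have := rpos y yD yx; lia.
Qed.

(** * Layers of the product with a cycle *)

(* The layers of a closed set of the product with a cycle, unrolled to an
   n-periodic sequence so that neighbouring layers have consecutive indices. *)
Definition closed_layers (T : finType) (e : rel T) (t n : nat)
    (A : nat -> {set T}) : Prop :=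
  (forall i, A (i + n) = A i) /\
  forall i x, t <= #|[set y in A i.+1 | e x y]| + (x \in A i) + (x \in A i.+2) ->
    x \in A i.+1.

Lemma cart_cycle_closed_layers (T : finType) (e : rel T) (t m : nat)
    (B : {set T * 'I_m.+3}) :
  threshold_closed (cart_prod e (@cycle_graph m.+3)) t B ->
  closed_layers e t m.+3 (fun i => [set x | (x, inord (i %% m.+3)) \in B]).
Proof.
move=> cB; split=> [i|i x]; first by apply/setP => x; rewrite !inE modnDr.
pose A i := [set x | (x, inord (i %% m.+3)) \in B].
move=> xt; have {}xt :
  t <= #|[set y in A i.+1 | e x y]| + (x \in A i) + (x \in A i.+2) by exact: xt.
rewrite inE; apply: cB; apply: leq_trans xt _.
have val_inord k : (inord (k %% m.+3) : 'I_m.+3) = k %% m.+3 :> nat.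
  by rewrite inordK // ltn_pmod.
set j0 : 'I_m.+3 := inord (i %% m.+3).
set j1 : 'I_m.+3 := inord (i.+1 %% m.+3).
set j2 : 'I_m.+3 := inord (i.+2 %% m.+3).
have succ k : (k %% m.+3).+1 %% m.+3 = k.+1 %% m.+3.
  by rewrite -addn1 modnDml addn1.
have e01 : j0.+1 %% m.+3 = j1 by rewrite !val_inord succ.
have e12 : j1.+1 %% m.+3 = j2 by rewrite !val_inord succ.
have succE (k : 'I_m.+3) : k.+1 %% m.+3 = if k.+1 == m.+3 then 0 else k.+1.
  case: eqP => [->|kn]; first by rewrite modnn.
  by rewrite modn_small //; have := ltn_ord k; lia.
(* With at least three layers the indices are distinct, so the neighbours below form disjoint sets
   and their numbers add up. *)
have j01 : j0 != j1 by apply/eqP => E; move: e01; rewrite succE E; case: eqP; lia.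
have j12 : j1 != j2 by apply/eqP => E; move: e12; rewrite succE E; case: eqP; lia.
have j02 : j0 != j2.
  by apply/eqP => E; move: e01 e12; rewrite !succE E; do 2!case: eqP; lia.
pose L (b : bool) (j : 'I_m.+3) : {set T * 'I_m.+3} :=
  if b then [set (x, j)] else set0.
have cL b j : #|L b j| = b by case: b; rewrite /L ?cards1 ?cards0.
pose N := [set (y, j1) | y in [set y in A i.+1 | e x y]].
have cN : #|N| = #|[set y in A i.+1 | e x y]|.
  by rewrite card_imset // => y z [].
have inL b j q : q \in L b j -> b /\ q = (x, j).
  by case: b; rewrite /L inE // => /eqP.
have inN q : q \in N -> q.2 = j1 by case/imsetP => y _ ->.
rewrite -cN -(cL (x \in A i) j0) -(cL (x \in A i.+2) j2).
have d1 : #|N :|: L (x \in A i) j0| = #|N| + #|L (x \in A i) j0|.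
  rewrite cardsU (_ : _ :&: _ = set0) ?cards0 ?subn0 //.
  apply/setP => q; rewrite !inE; apply/negP => /andP[/inN qj /inL[_ qE]].
  by move: j01; rewrite -qj qE eqxx.
rewrite -d1.
have d2 : #|N :|: L (x \in A i) j0 :|: L (x \in A i.+2) j2| =
    #|N :|: L (x \in A i) j0| + #|L (x \in A i.+2) j2|.
  rewrite cardsU (_ : _ :&: _ = set0) ?cards0 ?subn0 //.
  apply/setP => q; rewrite !inE; apply/negP => /andP[/orP[/inN qj|/inL[_ ->]] /inL[_ qE]].
    by move: j12; rewrite -qj qE eqxx.
  by case: qE => E; move: j02; rewrite E eqxx.
rewrite -d2; apply/subset_leq_card/subsetP => q; rewrite !inE.
case/orP=> [/orP[/imsetP[y]|/inL[xA ->]]|/inL[xA ->]].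
- by rewrite !inE => /andP[yB xy] ->; rewrite yB /cart_prod /= eqxx xy orbT.
- by rewrite xA /cart_prod /= eqxx /cycle_graph e01 eqxx orbT.
- by rewrite xA /cart_prod /= eqxx /cycle_graph e12 eqxx.
Qed.

(** Once layers 0 and 1 are full, each later layer has a full one below it, and the last lies
    between two full ones. For [m = 0] layer 2 is the last and receives [Sl], hence the guard
    [0 < m]. *)
Lemma dyn_cart_cycle_layers (T : finType) (e : rel T) (t m : nat)
    (S0 S1 S2 Sl : {set T}) :
  dynamic_monopoly e t.-1 S2 -> dynamic_monopoly e t.-2 Sl ->
  (forall A, closed_layers e t m.+3 A -> S0 \subset A 0 -> S1 \subset A 1 ->
     (0 < m -> S2 \subset A 2) -> Sl \subset A m.+2 ->
     A 0 = setT /\ A 1 = setT) ->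
  dyn (cart_prod e (@cycle_graph m.+3)) t <= #|S0| + #|S1| + m * #|S2| + #|Sl|.
Proof.
move=> /dynamic_monopolyP d2 /dynamic_monopolyP dl H.
pose F i := if i == 0 then S0 else if i == 1 then S1
            else if i == m.+2 then Sl else S2.
pose D := [set q : T * 'I_m.+3 | q.1 \in F q.2].
have cF : #|D| = \sum_(i < m.+3) #|F i|.
  rewrite -sum1_card (eq_bigl (fun q : T * 'I_m.+3 => predT q.1 && (q.1 \in F q.2))); last first.
    by move=> q; rewrite inE.
  rewrite -(pair_big_dep predT (fun x (i : 'I_m.+3) => x \in F i) (fun _ _ => 1)).
  rewrite (exchange_big_dep predT) //=; apply: eq_bigr => i _.
  by rewrite sum1_card.
have -> : #|S0| + #|S1| + m * #|S2| + #|Sl| = #|D|.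
  rewrite cF 2!big_ord_recl big_ord_recr /=.
  rewrite (eq_bigr (fun=> #|S2|)) => [|i _]; last first.
    by rewrite /F /bump /=; case: eqP => //; have := ltn_ord i; lia.
  rewrite sum_nat_const card_ord /bump /= !add1n /F /= eqxx; lia.
apply: dyn_le; apply/dynamic_monopolyP => B DB cB.
have := cart_cycle_closed_layers cB.
set A := (X in closed_layers _ _ _ X) => cA.
have FA i : i < m.+3 -> F i \subset A i.
  move=> im; apply/subsetP => x xF; rewrite inE modn_small //.
  by apply: (subsetP DB); rewrite inE /= inordK.
have SlA : Sl \subset A m.+2 by have := FA m.+2 (leqnn _); rewrite /F /= eqxx.
have [] := H A cA (FA 0 isT) (FA 1 isT) _ SlA.
  by move=> m0; have := FA 2 isT; rewrite /F /= ltn_eqF.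
move=> A0 A1; have [per step] := cA.
have AT i : i < m.+2 -> A i = setT.
  elim: i => // -[|i] IH im //; have {}IH := IH (ltnW im).
  apply: d2; first by have := FA i.+2 (ltnW im); rewrite /F /= ltn_eqF.
  by move=> x xt; apply: step; rewrite IH inE; lia.
have Al : A m.+2 = setT.
  apply: dl; first exact: SlA.
  by move=> x xt; apply: step; rewrite (per 0) A0 (AT m.+1) // !in_setT; lia.
apply/setP => -[x j]; rewrite inE.
have : x \in A j.
  have := ltn_ord j; rewrite leq_eqVlt eqSS => /predU1P[->|jm]; first by rewrite Al.
  by rewrite AT.
by rewrite inE modn_small // inord_val.
Qed.

Lemma two_nbrs (T : finType) (e : rel T) (A : {set T}) (x y z : T) :
  y \in A -> z \in A -> e x y -> e x z -> y != z ->
  1 < #|[set y in A | e x y]|.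
Proof.
by move=> yA zA xy xz yz; apply/card_gt1P; exists y, z; rewrite !inE yA zA xy xz.
Qed.

(** * Filling a layer with help from the adjacent ones *)

Lemma closed_layers_drop (T : finType) (e : rel T) (t n k : nat)
    (A : nat -> {set T}) (S : {set T}) (i : nat) :
  closed_layers e t n A -> dynamic_monopoly e k S -> S \subset A i.+1 ->
  (forall x, t - k <= (x \in A i) + (x \in A i.+2)) -> A i.+1 = setT.
Proof.
move=> [_ step] /dynamic_monopolyP dS SA bonus; apply: dS => // x xt.
by apply: step; have := bonus x; lia.
Qed.

(** Closedness is stated only at successor indices, so layer 0 is treated as layer [m.+3]. *)
Lemma closed_layers0 (T : finType) (e : rel T) (t m : nat) (A : nat -> {set T}) x :
  closed_layers e t m.+3 A ->
  t <= #|[set y in A 0 | e x y]| + (x \in A m.+2) + (x \in A 1) -> x \in A 0.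
Proof.
move=> [per step]; rewrite -(per 0) -(per 1) => xt; exact: step.
Qed.

Lemma closed_layers0_bonus (T : finType) (e : rel T) (t m : nat)
    (A : nat -> {set T}) x :
  closed_layers e t.+1 m.+3 A -> (x \in A m.+2) || (x \in A 1) ->
  t <= #|[set y in A 0 | e x y]| -> x \in A 0.
Proof.
move=> cA bonus xt; apply: (closed_layers0 cA).
by case/orP: bonus => ->; lia.
Qed.

Lemma closed_layers_above_full (T : finType) (e : rel T) (t n i : nat)
    (A : nat -> {set T}) x :
  closed_layers e t n A -> A i = setT ->
  t - 1 <= #|[set y in A i.+1 | e x y]| + (x \in A i.+2) -> x \in A i.+1.
Proof. by move=> [_ step] Ai xt; apply: step; rewrite Ai inE; lia. Qed.

Lemma ltn_cardD1 (T : finType) (P : {set T}) (x : T) k :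
  k < #|P| -> k <= #|P :\ x|.
Proof. by rewrite (cardsD1 x P); lia. Qed.

(** * Threshold 3 *)

(* Without [v], activation in rank order gets stuck only at neighbours of [v];
   helping the first two of them and [v] itself suffices. *)
Lemma rank_fill (T : finType) (e : rel T) (D A : {set T}) (r : T -> nat) (v w w' : T) :
  simple_graph e -> activation_rank e 3 D r -> dynamic_monopoly e 3 D ->
  threshold_closed e 3 A -> D :\ v \subset A ->
  e v w -> e v w' -> w != w' ->
  (forall y, e v y -> y != w -> y != w' -> r w <= r y /\ r w' <= r y) ->
  (forall x, x \in [:: v; w; w'] -> x \notin D :\ v ->
     1 < #|[set y in A | e x y]| -> x \in A) ->
  A = setT.
Proof.
move=> [es ei] [r0 rinj rt] /dynamic_monopolyP dD cA DA vw vw' ww' minr bonus.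
(* Strong induction on the rank: of three earlier neighbours only [v] can be missing, so only a
   neighbour of [v] can fall short. *)
have low y : r y <= maxn (r w) (r w') -> y != v -> y \in A.
  have [k] := ubnP (r y); elim: k y => // k IH y yk ym yv.
  case: (boolP (y \in D)) => yD; first by apply: (subsetP DA); rewrite !inE yv.
  have P3 := rt y yD; set P := [set z | _] in P3.
  have PA : P :\ v \subset [set z in A | e y z].
    apply/subsetP => z; rewrite !inE => /and3P[zv zy ->]; rewrite andbT.
    by apply: IH => //; lia.
  have := subset_leq_card PA; have := cardsD1 v P.
  case: (boolP (v \in P)) => [vP|_] cP PN; last by apply: cA; lia.
  have vy : e v y by move: vP; rewrite inE es => /andP[].
  apply: bonus; last by lia.
    (* A stuck [y] is [w] or [w']: its rank is at least both of theirs and at most the larger, and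
       ranks are injective off [D]. *)
    rewrite !inE (negbTE yv) /=; apply/norP => -[yw yw'].
    have [yr yr'] := minr y vy yw yw'.
    have : r y = r w \/ r y = r w' by lia.
    by case=> /(rinj _ _ yD) yE; [move: yw|move: yw']; rewrite yE eqxx.
  by rewrite !inE negb_and (negbTE yD) orbT.
have nv x : e v x -> x != v by move=> vx; apply: contraTneq vx => ->; rewrite ei.
have vA : v \in A.
  apply: bonus; rewrite ?inE ?eqxx //.
  by apply: (two_nbrs _ _ vw vw' ww'); apply: low; rewrite ?nv //; lia.
apply: dD => //; apply/subsetP => x xD.
by case: (eqVneq x v) => [->//|xv]; apply: (subsetP DA); rewrite !inE xv.
Qed.

(** With n = [m.+3] and d = [#|D|] the bound is (n-1)(d-1)+1 = nd-(n+d)+2. *)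
Lemma dyn3_cart_cycle (T : finType) (e : rel T) (m : nat) (D : {set T}) :
  simple_graph e -> connected_graph e -> (forall x, 3 <= degree e x) ->
  dynamic_monopoly e 3 D ->
  dyn (cart_prod e (@cycle_graph m.+3)) 3 <= m.+2 * #|D|.-1 + 1.
Proof.
move=> eG [T0 ec] deg dD; have [es ei] := eG.
have D3 := dynamic_monopoly_card_ge T0 deg dD.
have [r rk] := activation_rank_exists dD; have [r0 rinj rt] := rk.
have cD1 v : v \in D -> #|D :\ v| = #|D|.-1 by rewrite (cardsD1 v D) => ->.
have drop v (S : {set T}) : D :\ v \subset S -> dynamic_monopoly e 2 S.
  move=> DS; apply: (@dynamic_monopoly_drop _ e 3 1 D S deg dD).
  rewrite -(cards1 v); apply/subset_leq_card/subsetP => x; rewrite !inE.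
  case/andP=> xS xD; apply: contraNT xS => xv.
  by apply: (subsetP DS); rewrite !inE xv.
have cl1 x := @connected_dynamic_monopoly1 _ e x es ec.
(* Layers 0 and 2 to [m.+1] receive [D :\ v], layer 1 receives [S1] and the last layer [x]; it
   remains to fill layers 0 and 1. *)
have base v (S1 : {set T}) x : v \in D -> #|S1| = #|D|.-1 ->
    (forall A : nat -> {set T}, closed_layers e 3 m.+3 A -> D :\ v \subset A 0 -> S1 \subset A 1 ->
     (0 < m -> D :\ v \subset A 2) -> x \in A m.+2 ->
     A 0 = setT /\ A 1 = setT) ->
    dyn (cart_prod e (@cycle_graph m.+3)) 3 <= m.+2 * #|D|.-1 + 1.
  move=> vD cS1 H.
  apply: leq_trans (_ : #|D :\ v| + #|S1| + m * #|D :\ v| + #|[set x]| <= _).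
    apply: dyn_cart_cycle_layers; [exact: (drop v)|exact: cl1|].
    by move=> A cA DA S1A DA2; rewrite sub1set; apply: H.
  by rewrite cS1 cD1 // cards1; lia.
have cA03 A : closed_layers e 3 m.+3 A -> threshold_closed e 3 (A 0).
  by move=> cA x xt; apply: (closed_layers0 cA); lia.
have second v y : exists w, [/\ e v w, w != y
    & forall z, e v z -> z != y -> r w <= r z].
  have [w0 /andP[vw0 w0y]] : exists w0, e v w0 && (w0 != y).
    have /card_gt1P[a [b [ha hb ab]]] : 1 < #|[set z | e v z]| by apply: ltnW (deg v).
    rewrite !inE in ha hb; case: (eqVneq a y) => ay; last by exists a; rewrite ha.
    by exists b; rewrite hb -ay eq_sym.
  case: (@arg_minnP _ w0 (fun w => e v w && (w != y)) r).
    by rewrite vw0.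
  by move=> w /andP[vw wy] wmin; exists w; split=> // z vz zy; apply: wmin; rewrite vz.
(* For an edge [v w] inside [D], [w] is in layer 0 from the start; [v] is helped from layer 1, which
   omits some other [u], and [w'] from the last layer. *)
case: (boolP [exists v in D, exists z in D, e v z]) => [|indep].
  case/existsP=> v /andP[vD /existsP[w /andP[wD vw]]].
  have [w' [vw' w'w w'min]] := second v w.
  have [u uD uv] : exists2 u, u \in D & u != v.
    have /card_gt0P[u] : 0 < #|D :\ v| by rewrite cD1 //; lia.
    by rewrite !inE => /andP[uv uD]; exists u.
  apply: (base v (D :\ u) w') => //; first exact: cD1.
  move=> A cA DA0 DA1 _ w'A.
  have A0 : A 0 = setT.
    apply: (@rank_fill _ e D (A 0) r v w w') => //; first exact: cA03.
    - by rewrite eq_sym.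
    - by move=> y vy yw _; split; last exact: w'min; have /eqP -> : r w == 0 by rewrite r0.
    - move=> x xl xD xt; apply: (closed_layers0_bonus cA) => //.
      move: xl; rewrite !inE => /or3P[] /eqP xE.
      + by apply/orP; right; apply: (subsetP DA1); rewrite !inE xE eq_sym uv.
      + move: xD; rewrite !inE xE wD andbT negbK => /eqP wv.
        by move: vw; rewrite wv ei.
      + by rewrite xE w'A.
  split=> //; apply: (closed_layers_drop cA (drop u _ (subxx _)) DA1) => x.
  by rewrite A0 inE.
have ind v z : v \in D -> e v z -> z \notin D.
  move=> vD vz; apply: contraNN indep => zD.
  by apply/existsP; exists v; rewrite vD; apply/existsP; exists z; rewrite zD.
have [y0 y0D] : exists y0, y0 \notin D.
  have /card_gt0P[v vD] : 0 < #|D| by lia.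
  have [w [vw _ _]] := second v v.
  by exists w; apply: ind vw.
case: (@arg_minnP _ y0 (fun y => y \notin D) r) => // y yD ymin.
have /card_gt2P[a [b [c [[ha hb hc] [ab bc ca]]]]] := rt y yD.
(* By minimality of [y], its earlier neighbours lie in [D]. *)
have yN z : z \in [set z | (r z < r y) && e y z] -> z \in D /\ e z y.
  rewrite inE es => /andP[zy zE]; split=> //.
  by apply: contraLR zy => zD; rewrite -leqNgt; apply: ymin.
have [aD ay] := yN _ ha; have [bD yb] := yN _ hb; have [cD cy] := yN _ hc.
pose sec z w := [/\ e z w, w != y & forall x, e z x -> x != y -> r w <= r x].
have [wa sa] : exists w, sec a w := second a y.
have [wb sb] : exists w, sec b w := second b y.
have [wc sc] : exists w, sec c w := second c y.
have [v [u [u' [w [wu [[vD uD u'D] [vy uy] [uv u'v u'u] [sv su] alt]]]]]] :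
  exists v u u' w wu,
  [/\ [/\ v \in D, u \in D & u' \in D], e v y /\ e u y, [/\ u != v, u' != v & u' != u],
      sec v w /\ sec u wu
    & w = wu \/ forall x, e u' x -> x != y -> r wu < r x].
  (* If the second neighbours of [a] and [b] tie in rank, they coincide, lying outside [D], and [a],
     [b] serve as [v], [u]. Otherwise [u] is the one whose second neighbour comes earlier, and [u']
     is the other. *)
  case: (ltngtP (r wa) (r wb)) => rab.
  - exists c, a, b, wc, wa; split; rewrite // ?[a == c]eq_sym ?[b == a]eq_sym //.
    by right=> x bx xy; case: sb => _ _ /(_ x bx xy); apply: leq_trans.
  - exists c, b, a, wc, wb; split; rewrite // ?[a == c]eq_sym //.
    by right=> x ax xy; case: sa => _ _ /(_ x ax xy); apply: leq_trans.
  - exists a, b, c, wa, wb; split; rewrite // ?[b == a]eq_sym ?[c == b]eq_sym //.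
    by left; apply: rinj rab; case: sa => awa _ _; apply: ind awa.
have [vw wy wmin] := sv; have [uwu wuy wumin] := su.
apply: (base v (y |: (D :\ u :\ u')) w) => //.
  rewrite cardsU1 !inE (negbTE yD) !andbF.
  by rewrite (cardsD1 u D) uD (cardsD1 u' (D :\ u)) !inE u'u u'D.
move=> A cA DA0; rewrite subUset sub1set => /andP[yA SA] DA2 wA.
have SA1 x : x \in D -> x != u -> x != u' -> x \in A 1.
  by move=> xD xu xu'; apply: (subsetP SA); rewrite !inE xu xu'.
have vA1 : v \in A 1 by apply: SA1; rewrite // eq_sym.
have A0 : A 0 = setT.
  apply: (@rank_fill _ e D (A 0) r v y w) => //; first exact: cA03.
  - by rewrite eq_sym.
  - by move=> z vz zy _; split; [apply: ymin; apply: ind vz|apply: wmin].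
  - move=> x xl _ xt; apply: (closed_layers0_bonus cA) => //.
    by move: xl; rewrite !inE => /or3P[] /eqP ->; rewrite ?vA1 ?yA ?wA ?orbT.
have full1 x := closed_layers_above_full (x := x) cA A0.
have two1 x : 1 < #|[set z in A 1 | e x z]| -> x \in A 1.
  by move=> xt; apply: full1; apply: leq_trans xt (leq_addr _ _).
have one1 x z : x \in A 2 -> z \in A 1 -> e x z -> x \in A 1.
  move=> x2 z1 xz; apply: full1; rewrite x2 addn1 ltnS card_gt0.
  by apply/set0Pn; exists z; rewrite inE z1.
(* For [m > 0] the copies of [u] in layers 0 and 2 and its neighbour [y] suffice. For [m = 0] layer
   2 is the last and starts with [w] only, so a second neighbour of [u] is recovered first. *)
have uA1 : u \in A 1.
  case: (posnP m) => [m0|m_gt0]; last first.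
    by apply: one1 yA uy; apply: (subsetP (DA2 m_gt0)); rewrite !inE uv.
  rewrite m0 in wA.
  have wA1 : w \in A 1 by apply: one1 wA vA1 _; rewrite es.
  have wuA1 : wu \in A 1.
    case: alt => [<- //|altr].
    (* Apart from [y], no vertex of rank up to that of [wu] is adjacent to [u']. So of three earlier
       neighbours only [u] can be missing, and layer 0 makes up for it. *)
    have low x : x \notin D -> r x <= r wu -> x \in A 1.
      have [k] := ubnP (r x); elim: k x => // k IH x xk xD xw.
      case: (eqVneq x y) => [-> //|xy].
      have P3 := rt x xD; set P := [set z | _] in P3.
      have PA : P :\ u \subset [set z in A 1 | e x z].
        apply/subsetP => z; rewrite !inE => /and3P[zu zx xz]; rewrite xz andbT.
        case: (boolP (z \in D)) => zD; last first.
          by apply: IH (leq_trans zx xk) zD (leq_trans (ltnW zx) xw).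
        apply: SA1 => //; apply: contraTneq xw => zE.
        by rewrite -ltnNge; apply: altr => //; rewrite -zE es.
      by apply: two1; apply: leq_trans (subset_leq_card PA); apply: ltn_cardD1.
    by apply: low => //; apply: ind uwu.
  by apply: two1; apply: two_nbrs yA wuA1 uy uwu _; rewrite eq_sym.
(* Layer 1 now contains [D :\ u'], a monopoly at threshold 2, and layer 0 supplies the third
   neighbour. *)
split=> //; apply: (closed_layers_drop cA (drop u' (A 1) _) (subxx _)).
  apply/subsetP => x; rewrite !inE => /andP[xu' xD].
  by case: (eqVneq x u) => [-> //|xu]; apply: SA1.
by move=> x; rewrite A0 inE.
Qed.

(** * Thresholds 2 and at least 4, and the three bounds *)

(** Layer 0 fills up on its own and starts the chain; [m.+1] is n - 2, the number of middle
    layers. *)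
Lemma dyn_cart_cycle_chain (T : finType) (e : rel T) (t m : nat)
    (S0 S1 S2 : {set T}) :
  dynamic_monopoly e t S0 -> dynamic_monopoly e t.-1 S1 ->
  dynamic_monopoly e t.-2 S2 ->
  dyn (cart_prod e (@cycle_graph m.+3)) t <= #|S0| + m.+1 * #|S1| + #|S2|.
Proof.
move=> d0 d1 d2; rewrite mulSn addnA; apply: dyn_cart_cycle_layers => //.
move=> A cA S0A S1A _ _.
have A0 : A 0 = setT.
  apply: (proj1 (dynamic_monopolyP _ _ _) d0) => // x xt.
  by apply: (closed_layers0 cA); lia.
split=> //; apply: (closed_layers_drop cA d1 S1A) => x.
by rewrite A0 inE; lia.
Qed.

Theorem theorem9 (T : finType) (e : rel T) (n t : nat) (d : nat) :
  simple_graph e ->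
  connected_graph e ->
  3 <= n ->
  0 < t ->
  t <= min_degree e ->
  d = dyn e t ->
  let D := dyn (cart_prod e (@cycle_graph n)) t in
  [/\ t = 2 -> (D%:Z <= n%:Z + d%:Z - 2)%R,
      t = 3 -> (D%:Z <= n%:Z * d%:Z - (n%:Z + d%:Z) + 2)%R
    & 4 <= t -> (D%:Z <= d%:Z + (n%:Z - 2) * (d%:Z - 1) + d%:Z - 2)%R].

Proof.
move=> eG econ n3 t0 tmin -> /=.
have deg x : t <= degree e x := leq_trans tmin (min_degree_le e x).
have [D dD <-] := dyn_witness e t.
have [T0 ec] := econ; have [es _] := eG.
have Dt := dynamic_monopoly_card_ge T0 deg dD.
case: n n3 => [|[|[|m]]] // _; split=> tE.
(* By connectivity any single vertex serves in the middle layers, so the count is d + (n-2) + 0. *)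
- case/card_gt0P: T0 => x _; rewrite tE in dD Dt *.
  have d1 := @connected_dynamic_monopoly1 _ e x es ec.
  have d0 : dynamic_monopoly e 0 set0.
    by apply/dynamic_monopolyP => A _ cA; apply/setP => y; rewrite inE cA.
  have := dyn_cart_cycle_chain m dD d1 d0.
  by rewrite cards1 cards0; move: (dyn _ _) (#|_|) => D' k; lia.
- rewrite tE in dD deg Dt *.
  have := dyn3_cart_cycle m eG econ deg dD.
  by move: (dyn _ _) (#|_|) Dt => D' k; nia.
- have /card_gt1P[u [v [uD vD uv]]] : 1 < #|D| by lia.
  have sub k (S : {set T}) : S \subset D -> #|D| - #|S| <= k -> dynamic_monopoly e (t - k) S.
    move=> SD kS; apply: dynamic_monopoly_drop deg dD _.
    by rewrite cardsD (setIidPr SD).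
  have cu := cardsD1 u D; have cv := cardsD1 v (D :\ u).
  rewrite uD in cu; rewrite !inE vD eq_sym uv in cv.
  have d1 : dynamic_monopoly e t.-1 (D :\ u).
    by rewrite -subn1; apply: sub; rewrite ?subsetDl //; lia.
  have d2 : dynamic_monopoly e t.-2 (D :\ u :\ v).
    rewrite -subn2; apply: sub; last by lia.
    by rewrite !subDset subsetU ?subxx ?orbT // subsetU ?subxx ?orbT.
  have := dyn_cart_cycle_chain m dD d1 d2.
  move: (dyn _ _) cu cv => D' /= cu cv; rewrite cu cv; nia.
Qed.
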